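(* Let $\mu_-<\mu_+$ and let $\omega:[0,\infty)\times(\mu_-,\mu_+)\to[0,\infty)$ be a parametrised weight function, all of whose moments $\mathfrak{m}_m(\mu)=\int_0^\infty x^m\omega(x,\mu)\,dx$, $m=0,1,2,\ldots$, exist, with $\mathfrak{m}_0(\mu)\equiv1$. Suppose there are real sequences $\{\alpha_m\},\{\beta_m\},\{\gamma_m\},\{\delta_m\}$, $m=0,1,2,\ldots$, with $\alpha_k\delta_\ell-\beta_k\gamma_\ell\ne0$ for all $0\le k\le\ell$, such that $$\mathfrak{m}_{m+1}(\mu)=\frac{\alpha_m+\beta_m\mu}{\gamma_m+\delta_m\mu}\,\mathfrak{m}_m(\mu),\qquad m=0,1,2,\ldots,\quad\mu\in(\mu_-,\mu_+),$$ where $\gamma_m+\delta_m\mu\neq0$ on $(\mu_-,\mu_+)$. Assume that $\beta_\ell\ne0$ for all $\ell\ge0$ and $\alpha_j\beta_\ell\neq\alpha_\ell\beta_j$ for all $\ell,j\geq0$ with $\ell\ne j$. Let $n\ge1$, let $\mu_1,\ldots,\mu_n\in(\mu_-,\mu_+)$ be distinct, assume that $\alpha_\ell\delta_k-\beta_\ell\gamma_k\ne0$ for $0\le\ell\le n$, $0\le k\le n-1$, and set $$\tilde q_\ell=\frac{\prod_{k=1}^n(\alpha_\ell+\beta_\ell\mu_k)}{\prod_{k=0}^{n-1}(\alpha_\ell\delta_k-\beta_\ell\gamma_k)},\qquad \ell=0,1,\ldots,n.$$ Then the $n$th biorthogonal polynomial of $\omega$ with parameters $\mu_1,\ldots,\mu_n$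 is, up to a nonzero multiplicative constant, $$p_n(x;\mu_1,\mu_2,\ldots,\mu_n)=\sum_{k=0}^n F_k[\tilde q_0,\tilde q_1,\ldots,\tilde q_k]\,x^k,$$ where $F_k$ are the generalized divided differences defined in the context.
   Context: Biorthogonal polynomial: for distinct $\mu_1,\ldots,\mu_n\in(\mu_-,\mu_+)$, $p_n(\,\cdot\,;\mu_1,\ldots,\mu_n)$ is a polynomial in $x$ of degree at most $n$, not identically zero, such that $\int_0^\infty p_n(x;\mu_1,\ldots,\mu_n)\,\omega(x,\mu_\ell)\,dx=0$ for $\ell=1,2,\ldots,n$. It is determined up to a nonzero multiplicative constant. Generalized divided differences: let $\lambda_j=-\alpha_j/\beta_j$ and $$M_j(x)=\frac{\alpha_j+\beta_jx}{\gamma_j+\delta_jx}.$$ For a sequence $\{r_\ell\}$ and indices $i_0<i_1<\cdots<i_k$, define recursively $F_0[r_{i_0}]=r_{i_0}$ and, for $k\ge1$, $$F_k[r_{i_0},\ldots,r_{i_{k-1}},r_{i_k}]=\frac{F_{k-1}[r_{i_0},\ldots,r_{i_{k-2}},r_{i_k}]-F_{k-1}[r_{i_0},\ldots,r_{i_{k-2}},r_{i_{k-1}}]}{M_{k-1}(\lambda_{i_k})}.$$ (The value of $F_k$ depends on the indices $i_1,\ldots,i_k$ through the points $\lambda_{i_1},\ldots,\lambda_{i_k}$.) *)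

(* Defs.v *)
(* MathComp-Analysis *)
From HB Require Import structures.
From mathcomp Require Import all_boot all_order all_algebra.
From mathcomp Require Import all_classical all_reals all_analysis.
Set Implicit Arguments.
Unset Strict Implicit.
Unset Printing Implicit Defensive.
Import Order.TTheory GRing.Theory Num.Theory.
Import numFieldNormedType.Exports.

Local Open Scope classical_set_scope.
Local Open Scope ring_scope.

(* A parametrised weight is a total function [w x t], of which only the values
   at [0 <= x] and at parameters [t] of the open interval matter. *)
Definition moments_exist (R : realType) (w : R -> R -> R) (t : R) : Prop :=
  forall m : nat, (@lebesgue_measure R).-integrable `[0 : R, +oo[%classic
    (fun x => (x ^+ m * w x t)%:E).

Definition moment (R : realType) (w : R -> R -> R) (m : nat) (t : R) : R :=
  (\int[@lebesgue_measure R]_(x in `[0 : R, +oo[%classic) (x ^+ m * w x t))%R.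

(* The integrals are real-valued; they are integrals of integrable functions as
   soon as all the moments of [w] exist at the points [mu l]. *)
Definition biorthogonal (R : realType) (w : R -> R -> R) (n : nat)
    (mu : 'I_n -> R) (p : {poly R}) : Prop :=
  [/\ p != 0, (size p <= n.+1)%N &
      forall l : 'I_n,
        (\int[@lebesgue_measure R]_(x in `[0 : R, +oo[%classic)
           (p.[x] * w x (mu l)))%R = 0].

Definition moebius (R : realType) (alpha beta gamma delta : nat -> R)
    (j : nat) (x : R) : R :=
  (alpha j + beta j * x) / (gamma j + delta j * x).

Definition lambda (R : realType) (alpha beta : nat -> R) (j : nat) : R :=
  - (alpha j / beta j).

Section GeneralizedDividedDifferences.
Variables (R : realType) (alpha beta gamma delta : nat -> R) (r : nat -> R).

(* [gdd_last k i l] is F_k[r_(i 0), ..., r_(i (k-1)), r_l]: the last index is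
   kept apart from the first k ones, because the recursion replaces it. *)
Fixpoint gdd_last (k : nat) (i : nat -> nat) (l : nat) : R :=
  if k is k'.+1 then
    (gdd_last k' i l - gdd_last k' i (i k'))
      / moebius alpha beta gamma delta k' (lambda alpha beta l)
  else r l.

(* F_k[r_(i 0), ..., r_(i k)]; only the values of [i] up to [k] are used. *)
Definition gdd (k : nat) (i : nat -> nat) : R := gdd_last k i (i k).

End GeneralizedDividedDifferences.

Definition qtilde (R : realType) (alpha beta gamma delta : nat -> R) (n : nat)
    (mu : 'I_n -> R) (l : nat) : R :=
  (\prod_(k < n) (alpha l + beta l * mu k))
    / (\prod_(k < n) (alpha l * delta k - beta l * gamma k)).

(* Main.v *)
(* With [p = \sum_k p_k x^k], the moment recursion gives
   [\int p w(., t) = \sum_k p_k \prod_(j < k) M_j(t)]; multiplying by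
   [\prod_(j < n) (gamma_j + delta_j t)] turns this into a polynomial [T p] in
   [t] of degree at most [n], so [p] is biorthogonal iff [T p] is a nonzero
   multiple of [\prod_k (t - mu_k)].  Since [M_l (lambda_l) = 0], the values at
   [lambda_0, ..., lambda_n] form a triangular system in the [p_k]; hence [T] is
   injective, and the generalized divided differences of the [qtilde_l] are the
   Newton-type solution of [T p = \prod_k (t - mu_k)]. *)
Require Import Defs.
From HB Require Import structures.
From mathcomp Require Import all_boot all_order all_algebra.
From mathcomp Require Import all_classical all_reals all_analysis.
From mathcomp Require Import ring.
Set Implicit Arguments.
Unset Strict Implicit.
Unset Printing Implicit Defensive.
Import Order.TTheory GRing.Theory Num.Theory.
Import numFieldNormedType.Exports.

Local Open Scope classical_set_scope.
Local Open Scope ring_scope.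

(** * Polynomials determined by their zeros *)

Lemma poly_roots_eq0 (F : idomainType) (n : nat) (p : {poly F}) (x : 'I_n -> F) :
  injective x -> (size p <= n)%N -> (forall i, p.[x i] = 0) -> p = 0.
Proof.
move=> x_inj szp px0; apply/eqP/negPn/negP => p_neq0.
have all_root : all (root p) [seq x i | i <- enum 'I_n].
  by apply/allP => _ /mapP[i _ ->]; apply/rootP.
have := max_poly_roots p_neq0 all_root.
by rewrite map_inj_uniq// enum_uniq size_map size_enum_ord ltnNge szp => /(_ isT).
Qed.

Lemma poly_roots_prod (F : idomainType) (n : nat) (p : {poly F}) (x : 'I_n -> F) :
  injective x -> (size p <= n.+1)%N -> (forall i, p.[x i] = 0) ->
  p = p`_n *: \prod_(i < n) ('X - (x i)%:P).
Proof.
move=> x_inj szp px0; set q := \prod_(i < n) _.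
have szq : size q = n.+1.
  by rewrite size_prod_XsubC /index_enum -enumT size_enum_ord.
have qn1 : q`_n = 1.
  have /monicP := monic_prod_XsubC (index_enum 'I_n) xpredT x.
  by rewrite lead_coefE -/q szq.
apply/subr0_eq/(poly_roots_eq0 x_inj) => [|i].
  apply/leq_sizeP => j; rewrite leq_eqVlt coefB coefZ.
  case/predU1P => [<-|lt_nj]; first by rewrite qn1 mulr1 subrr.
  rewrite (nth_default _ (leq_trans szp lt_nj)) [q`_j]nth_default ?szq//.
  by rewrite mulr0 subr0.
rewrite hornerD hornerN hornerZ px0 horner_prod (bigD1 i)//=.
by rewrite hornerXsubC subrr mul0r mulr0 subr0.
Qed.

(** * Integrals against the weight in terms of moments *)

Lemma Rintegral_poly_mul (R : realType) (w : R -> R -> R) (t : R) (n : nat)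
    (p : {poly R}) :
  moments_exist w t -> (size p <= n)%N ->
  (\int[@lebesgue_measure R]_(x in `[0%R, +oo[%classic) (p.[x] * w x t))%R =
  \sum_(k < n) p`_k * moment w k t.
Proof.
move=> wm szp.
have mD : measurable (`[0%R, +oo[%classic : set (measurableTypeR R)).
  exact: measurable_itv.
have intk k : (@lebesgue_measure R).-integrable `[0%R, +oo[%classic
    (fun x => (p`_k * (x ^+ k * w x t))%:E).
  exact: (integrableZl _ p`_k (wm k)).
have -> : (fun x => p.[x] * w x t) =
    (fun x => \sum_(k < n) p`_k * (x ^+ k * w x t)).
  apply/funext => x; rewrite (horner_coef_wide _ szp) mulr_suml.
  by apply: eq_bigr => k _; rewrite mulrA.
rewrite /Rintegral; under eq_integral do rewrite -sumEFin.
rewrite (integral_sum mD (fun k : 'I_n => intk k)).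
(* [fine] is additive only on finite values, which integrability supplies. *)
rewrite -sum_fine => [|k _]; last exact: (integrable_fin_num mD).
by apply: eq_bigr => k _; rewrite -(RintegralZl _ mD (wm k)).
Qed.

(** * Newton-type sums built on products of Moebius maps *)

Section Moebius.
Variables (R : realType) (alpha beta gamma delta : nat -> R).

Local Notation M := (moebius alpha beta gamma delta).
Local Notation lam := (lambda alpha beta).

Lemma moment_prod (w : R -> R -> R) (t : R) (k : nat) :
  moment w 0 t = 1 ->
  (forall m, moment w m.+1 t = M m t * moment w m t) ->
  moment w k t = \prod_(j < k) M j t.
Proof.
move=> w0 wS; elim: k => [|k IHk]; first by rewrite big_ord0.
by rewrite wS IHk big_ord_recr/= mulrC.
Qed.

(** Analogue of the Newton form of an interpolant, with nodes [lam j] and with [M j t] in place of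
    [t - lam j]. *)
Definition newton_sum (n : nat) (a : nat -> R) (t : R) : R :=
  \sum_(k < n) a k * \prod_(j < k) M j t.

Hypothesis hbeta : forall l, beta l != 0.

Lemma moebius_lambda (l : nat) : M l (lam l) = 0.
Proof. by rewrite /moebius /lambda mulrN mulrCA divff// mulr1 subrr mul0r. Qed.

Lemma newton_sum_lambda (n l : nat) (a : nat -> R) :
  (l < n)%N -> newton_sum n a (lam l) = newton_sum l.+1 a (lam l).
Proof.
move=> ltln; rewrite /newton_sum (big_ord_widen _ (fun k => a k *
  \prod_(j < k) M j (lam l)) ltln) [RHS]big_mkcond; apply: eq_bigr => k _.
case: ifPn => //; rewrite -leqNgt => ltlk.
by rewrite (bigD1 (Ordinal ltlk))//= moebius_lambda mul0r mulr0.
Qed.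

(** Row [l] of the triangular system has the diagonal entry [\prod_(j < l) M j (lam l)], which is
    nonzero, so forward substitution applies. *)
Lemma newton_sum_eq0 (n : nat) (a : nat -> R) :
  (forall l j, (l < n)%N -> (j < l)%N -> M j (lam l) != 0) ->
  (forall l, (l < n)%N -> newton_sum n a (lam l) = 0) ->
  forall l, (l < n)%N -> a l = 0.
Proof.
move=> M_neq0 a0; elim/ltn_ind => l IHl ltln; apply/eqP.
move: (a0 l ltln); rewrite newton_sum_lambda// /newton_sum big_ord_recr/=.
rewrite big1 => [|k _]; last by rewrite IHl ?mul0r// (ltn_trans _ ltln).
by rewrite add0r => /eqP; rewrite mulf_eq0 => /orP[//|/prodf_eq0[j _]];
  rewrite (negPf (M_neq0 _ _ _ _)).
Qed.

Lemma newton_sum_gdd (n l : nat) (r : nat -> R) :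
  (l < n)%N -> (forall j, (j < l)%N -> M j (lam l) != 0) ->
  newton_sum n (fun k => gdd alpha beta gamma delta r k id) (lam l) = r l.
Proof.
move=> ltln M_neq0; rewrite newton_sum_lambda// /newton_sum big_ord_recr/=.
set g := gdd_last alpha beta gamma delta r.
(* Newton partial sum plus remainder. The recursion gives [g m.+1 id l * M m (lam l) = g m id l - g
   m id m], so the total does not depend on [m]: it is [r l] at [m = 0] and the claim at [m = l]. *)
suff tele m : (m <= l)%N -> \sum_(k < m) g k id k * \prod_(j < k) M j (lam l) +
    g m id l * \prod_(j < m) M j (lam l) = r l by exact: tele.
elim: m => [_|m IHm ltml]; first by rewrite !big_ord0 add0r mulr1.
rewrite -[RHS](IHm (ltnW ltml)) !big_ord_recr/= -addrA; congr (_ + _).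
by rewrite [_ * M m _]mulrC mulrA divfK ?M_neq0// -mulrDl addrC subrK.
Qed.

(** * The transform [T] with denominators cleared *)

(** Multiplying by all [n] denominators turns the first [k] of them into numerators and leaves the
    others. Being a polynomial, it can be tested by counting zeros. *)
Definition cleared_transform (n : nat) (p : {poly R}) : {poly R} :=
  \sum_(k < n.+1) p`_k *: \prod_(j < n)
    (if (j < k)%N then (alpha j)%:P + beta j *: 'X
     else (gamma j)%:P + delta j *: 'X).

Local Notation T := cleared_transform.

Lemma cleared_transformB (n : nat) (p q : {poly R}) : T n (p - q) = T n p - T n q.
Proof.
by rewrite /T -sumrB; apply: eq_bigr => k _; rewrite coefB scalerBl.
Qed.

Lemma cleared_transformZ (n : nat) (c : R) (p : {poly R}) :
  T n (c *: p) = c *: T n p.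
Proof.
by rewrite /T scaler_sumr; apply: eq_bigr => k _; rewrite coefZ scalerA.
Qed.

Lemma size_affine (a b : R) : (size (a%:P + b *: 'X)%R <= 2)%N.
Proof.
rewrite (leq_trans (size_polyD _ _))// geq_max.
rewrite (leq_trans (size_polyC_leq1 _))//=.
by rewrite (leq_trans (size_scale_leq _ _))// size_polyX.
Qed.

Lemma size_cleared_transform (n : nat) (p : {poly R}) : (size (T n p) <= n.+1)%N.
Proof.
apply: (leq_trans (size_sum _ _ _)); apply/bigmax_leqP => k _.
apply: (leq_trans (size_scale_leq _ _)).
apply: (leq_trans (size_poly_prod_leq _ _)).
rewrite card_ord leq_subLR addnS ltnS.
rewrite (@leq_trans (\sum_(j < n) 2)%N)//; last first.
  by rewrite sum_nat_const card_ord muln2 addnn.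
by apply: leq_sum => j _; case: ifP => _; exact: size_affine.
Qed.

Lemma horner_cleared_transform (n : nat) (p : {poly R}) (t : R) :
  (forall j, (j < n)%N -> gamma j + delta j * t != 0) ->
  (T n p).[t] =
    newton_sum n.+1 (nth 0 p) t * \prod_(j < n) (gamma j + delta j * t).
Proof.
move=> den; rewrite /T horner_sum mulr_suml; apply: eq_bigr => k _.
rewrite hornerZ -mulrA horner_prod; congr (_ * _).
have lekn : (k <= n)%N by rewrite -ltnS.
(* Padding the product with ones up to [n] lets each factor meet its own denominator. *)
rewrite (big_ord_widen n (M ^~ t) lekn) [X in _ = X * _]big_mkcond/= -big_split/=.
apply: eq_bigr => j _; case: ifP => _; rewrite hornerD hornerC hornerZ hornerX.
  by rewrite /moebius divfK ?den.
by rewrite mul1r.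
Qed.

(** * Values at the nodes [lam l] *)

Lemma denominator_lambda (j l : nat) :
  gamma j + delta j * lam l = (alpha l * delta j - beta l * gamma j) / - beta l.
Proof. by rewrite /lambda; field. Qed.

Lemma lambda_sub (t : R) (l : nat) :
  lam l - t = (alpha l + beta l * t) / - beta l.
Proof. by rewrite /lambda; field. Qed.

(** Identifies the data to interpolate: the target polynomial divided by the cleared denominators.
    Both products carry [n] factors [/ - beta l], which cancel. *)
Lemma qtilde_lambda (n l : nat) (mu : 'I_n -> R) :
  qtilde alpha beta gamma delta mu l =
  (\prod_(k < n) (lam l - mu k)) / \prod_(k < n) (gamma k + delta k * lam l).
Proof.
under [X in X / _]eq_bigr do rewrite lambda_sub.
under [X in _ / X]eq_bigr do rewrite denominator_lambda.
rewrite !big_split/= invfM mulrACA divff ?mulr1//.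
by apply/prodf_neq0 => k _; rewrite invr_eq0 oppr_eq0.
Qed.

Hypothesis hlambda :
  forall l j : nat, l != j -> alpha j * beta l != alpha l * beta j.

Lemma lambda_inj : injective lam.
Proof.
move=> l j lam_eq; apply/eqP/negPn/negP => /hlambda/negP; apply; apply/eqP.
have /oppr_inj/eqP := lam_eq.
by rewrite eqr_div// => /eqP ->.
Qed.

Variable n : nat.
Hypothesis hdet : forall l k : nat, (l <= n)%N -> (k < n)%N ->
  alpha l * delta k - beta l * gamma k != 0.

Lemma denominator_lambda_neq0 (j l : nat) :
  (l <= n)%N -> (j < n)%N -> gamma j + delta j * lam l != 0.
Proof.
move=> leln ltjn; rewrite denominator_lambda mulf_neq0 ?hdet//.
by rewrite invr_eq0 oppr_eq0.
Qed.

(** The numerator of [M j] vanishes only at [lam j], which differs from [lam l]; the denominator is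
    covered because [j < l <= n]. *)
Lemma moebius_lambda_neq0 (l j : nat) :
  (l <= n)%N -> (j < l)%N -> M j (lam l) != 0.
Proof.
move=> leln ltjl; rewrite /moebius mulf_neq0//; last first.
  by rewrite invr_eq0 denominator_lambda_neq0// (leq_trans ltjl).
apply/eqP => num0.
have /lambda_inj jl : lam j = lam l.
  apply: (mulfI (hbeta j)); rewrite [LHS]mulrN mulrCA divff// mulr1.
  by apply/eqP; rewrite eq_sym -addr_eq0 addrC num0.
by rewrite jl ltnn in ltjl.
Qed.

(** At each node the denominators are nonzero, so the Newton sum itself vanishes there and the
    triangular system applies. *)
Lemma cleared_transform_inj (p : {poly R}) :
  (size p <= n.+1)%N -> T n p = 0 -> p = 0.
Proof.
move=> szp Tp0; apply/polyP => l; rewrite coef0.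
case: (ltnP l n.+1) => [ltln|lenl]; last by rewrite nth_default// (leq_trans szp).
apply: (newton_sum_eq0 (n := n.+1)) ltln => [i j|i lein].
  exact: moebius_lambda_neq0.
apply/eqP; have /eqP := congr1 (horner^~ (lam i)) Tp0.
rewrite horner_cleared_transform => [|j ltjn].
  rewrite horner0 mulf_eq0 => /orP[//|/prodf_eq0[j _]].
  by rewrite (negPf (denominator_lambda_neq0 _ _)).
exact: denominator_lambda_neq0.
Qed.

Definition gdd_poly (mu : 'I_n -> R) : {poly R} := \sum_(k < n.+1)
  gdd alpha beta gamma delta (qtilde alpha beta gamma delta mu) k id *: 'X^k.

Lemma gdd_polyE (mu : 'I_n -> R) : gdd_poly mu = \poly_(k < n.+1)
  gdd alpha beta gamma delta (qtilde alpha beta gamma delta mu) k id.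
Proof. by rewrite poly_def. Qed.

(** Both sides have degree at most [n], so agreement at the [n.+1] distinct nodes suffices. *)
Lemma cleared_transform_gdd (mu : 'I_n -> R) :
  T n (gdd_poly mu) = \prod_(k < n) ('X - (mu k)%:P).
Proof.
apply/subr0_eq/(@poly_roots_eq0 _ n.+1 _ (fun l => lam l)).
- by move=> i j /lambda_inj/val_inj.
- rewrite (leq_trans (size_polyD _ _))// geq_max size_cleared_transform.
  by rewrite size_polyN size_prod_XsubC /index_enum -enumT size_enum_ord/=.
move=> l; rewrite hornerD hornerN horner_prod.
have leln : (l <= n)%N by rewrite -ltnS.
rewrite horner_cleared_transform => [|j]; last exact: denominator_lambda_neq0.
under [X in _ - X]eq_bigr do rewrite hornerXsubC.
have -> : newton_sum n.+1 (nth 0 (gdd_poly mu)) (lam l) =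
    qtilde alpha beta gamma delta mu l.
  rewrite -(newton_sum_gdd (qtilde alpha beta gamma delta mu)
    (ltn_ord l)) => [|j]; last exact: moebius_lambda_neq0.
  by apply: eq_bigr => k _; rewrite gdd_polyE coef_poly ltn_ord.
rewrite qtilde_lambda divfK ?subrr//.
by apply/prodf_neq0 => k _; exact: denominator_lambda_neq0.
Qed.

End Moebius.

(** * Characterisation of the biorthogonal polynomials *)

Theorem theorem3 (R : realType) (mu_minus mu_plus : \bar R)
    (hmu : (mu_minus < mu_plus)%E)
    (w : R -> R -> R)
    (w_ge0 : forall x t : R, 0 <= x -> (mu_minus < t%:E < mu_plus)%E ->
      0 <= w x t)
    (w_moments : forall t : R, (mu_minus < t%:E < mu_plus)%E ->
      moments_exist w t)
    (w_moment0 : forall t : R, (mu_minus < t%:E < mu_plus)%E ->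
      moment w 0 t = 1)
    (alpha beta gamma delta : nat -> R)
    (hdet : forall k l : nat, (k <= l)%N ->
      alpha k * delta l - beta k * gamma l != 0)
    (hden : forall (m : nat) (t : R), (mu_minus < t%:E < mu_plus)%E ->
      gamma m + delta m * t != 0)
    (hrec : forall (m : nat) (t : R), (mu_minus < t%:E < mu_plus)%E ->
      moment w m.+1 t = moebius alpha beta gamma delta m t * moment w m t)
    (hbeta : forall l : nat, beta l != 0)
    (hlambda : forall l j : nat, l != j ->
      alpha j * beta l != alpha l * beta j)
    (n : nat) (hn : (1 <= n)%N)
    (mu : 'I_n -> R)
    (hmu_in : forall l : 'I_n, (mu_minus < (mu l)%:E < mu_plus)%E)
    (hmu_inj : injective mu)
    (hdet_n : forall l k : nat, (l <= n)%N -> (k < n)%N ->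
      alpha l * delta k - beta l * gamma k != 0) :
  forall p : {poly R},
    biorthogonal w mu p <->
    exists2 c : R, c != 0 &
      p = c *: \sum_(k < n.+1)
        gdd alpha beta gamma delta (qtilde alpha beta gamma delta mu) k id
          *: 'X^k.
Proof.
rewrite -/(gdd_poly alpha beta gamma delta mu); set S := gdd_poly _ _ _ _ _.
have TS := cleared_transform_gdd hbeta hlambda hdet_n mu; rewrite -/S in TS.
have szS : (size S <= n.+1)%N by rewrite /S gdd_polyE size_poly.
(* The two quantities differ by the product of the denominators at [mu l], nonzero by [hden]. *)
have intT (q : {poly R}) l : (size q <= n.+1)%N ->
    ((\int[@lebesgue_measure R]_(x in `[0%R, +oo[%classic)
      (q.[x] * w x (mu l)))%R == 0) =
    ((cleared_transform alpha beta gamma delta n q).[mu l] == 0).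
  move=> szq; rewrite (Rintegral_poly_mul (w_moments _ (hmu_in l)) szq).
  rewrite horner_cleared_transform => [|j _]; last exact: hden.
  under eq_bigr => k _ do rewrite (moment_prod k (w_moment0 _ (hmu_in l))
    (fun m => hrec m _ (hmu_in l))).
  have den_neq0 : \prod_(j < n) (gamma j + delta j * mu l) != 0.
    by apply/prodf_neq0 => j _; exact: hden.
  by rewrite mulf_eq0 (negPf den_neq0) orbF.
move=> p; split=> [[p_neq0 szp int0]|[c c_neq0 ->]].
  set Tp := cleared_transform alpha beta gamma delta n p.
  have Tp_prod : Tp = Tp`_n *: \prod_(i < n) ('X - (mu i)%:P).
    apply: poly_roots_prod => // [|l]; first exact: size_cleared_transform.
    by apply/eqP; rewrite -intT//; apply/eqP.
  (* Both sides have the same image under the injective transform. *)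
  have p_S : p = Tp`_n *: S.
    apply/subr0_eq/(cleared_transform_inj hbeta hlambda hdet_n).
      rewrite (leq_trans (size_polyD _ _))// geq_max szp size_polyN.
      by rewrite (leq_trans (size_scale_leq _ _)).
    by rewrite cleared_transformB cleared_transformZ TS -Tp_prod subrr.
  exists Tp`_n => //; apply: contra_neq p_neq0 => c0.
  by rewrite p_S c0 scale0r.
have szcS : (size (c *: S) <= n.+1)%N by rewrite (leq_trans (size_scale_leq _ _)).
split=> // [|l].
  (* If [S] were zero, its transform, a monic polynomial, would be zero. *)
  rewrite scaler_eq0 negb_or c_neq0/=; apply/eqP => S0.
  have : \prod_(k < n) ('X - (mu k)%:P) \is monic by exact: monic_prod_XsubC.
  move/monic_neq0/eqP; apply; rewrite -TS S0 /cleared_transform big1// => k _.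
  by rewrite coef0 scale0r.
apply/eqP; rewrite intT// cleared_transformZ TS hornerZ horner_prod (bigD1 l)//=.
by rewrite hornerXsubC subrr mul0r mulr0.
Qed.
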